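(* Assume that the coefficients $A,B,C,D,L,Q,R$ of the generalized Riccati differential equation are constant and that the matrix $\begin{pmatrix}Q&L'\\L&R\end{pmatrix}$ is positive definite. Then the flow $M_t$ of this equation is a strict contraction in the Thompson metric on the set $S^n_{++}$ of positive definite matrices, i.e. $d_T(M_t(P_1),M_t(P_2))<d_T(P_1,P_2)$ for all $P_1\neq P_2$ in $S^n_{++}$ and all $t>0$ such that both solutions are defined in $S^n_{++}$ on $[0,t]$. Moreover this contraction is uniform on any subset bounded from above in the Loewner order: for every $\mathcal{S}\subset S^n_{++}$ for which there is $P_0\in S^n_{++}$ with $P\leq P_0$ for all $P\in\mathcal{S}$, there is $\alpha>0$ such that $d_T(M_t(P_1),M_t(P_2))\leq e^{-\alpha t}d_T(P_1,P_2)$ for all $P_1,P_2\in\mathcal{S}$ and all $t\geq 0$ such that $M_r(P_1),M_r(P_2)\in\mathcal{S}$ for all $r\in[0,t]$.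
   Context: $S^n$ is the set of real symmetric $n\times n$ matrices, $S^n_+$ (resp. $S^n_{++}$) the subset of positive semi-definite (resp. positive definite) ones; $\leq$ is the Loewner order ($X\leq Y$ iff $Y-X\in S^n_+$); $'$ denotes transpose. For $X\in S^n$, $Y\in S^n_{++}$, $M(X/Y)=\inf\{t\in\mathbb{R}:X\leq tY\}$, and the Thompson metric on $S^n_{++}$ is $d_T(X,Y)=\log\max\{M(X/Y),M(Y/X)\}$. The generalized Riccati differential equation (GRDE) is $\dot P=\phi(P)$, $P(0)=G$, with $R+D'PD$ positive definite, where $$\phi(P)=A'P+PA+C'PC+Q-(B'P+D'PC+L)'(R+D'PD)^{-1}(B'P+D'PC+L),$$ with $A,C\in\mathbb{R}^{n\times n}$, $B,D\in\mathbb{R}^{n\times k}$, $L\in\mathbb{R}^{k\times n}$, $Q\in S^n$, $R\in S^k$. $M_t(G)$ denotes the value at time $t$ of its maximal solution in $S^n_{++}$ with $P(0)=G\in S^n_{++}$. *)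

(* Defs.v *)
From HB Require Import structures.
From mathcomp Require Import all_boot all_order all_algebra.
From mathcomp Require Import all_classical all_reals all_analysis.

Set Implicit Arguments.
Unset Strict Implicit.
Unset Printing Implicit Defensive.

Import Order.TTheory GRing.Theory Num.Theory.
Import numFieldNormedType.Exports.

Local Open Scope classical_set_scope.
Local Open Scope ring_scope.

Definition psd {F : realType} {n : nat} (X : 'M[F]_n) : Prop :=
  X^T = X /\ forall x : 'cV[F]_n, 0 <= (x^T *m X *m x) 0 0.

Definition posdef {F : realType} {n : nat} (X : 'M[F]_n) : Prop :=
  X^T = X /\ forall x : 'cV[F]_n, x != 0 -> 0 < (x^T *m X *m x) 0 0.

Definition loewner_le {F : realType} {n : nat} (X Y : 'M[F]_n) : Prop :=
  psd (Y - X).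

(* M(X/Y) *)
Definition gauge {F : realType} {n : nat} (X Y : 'M[F]_n) : F :=
  inf [set t : F | loewner_le X (t *: Y)].

Definition thompson {F : realType} {n : nat} (X Y : 'M[F]_n) : F :=
  ln (Num.max (gauge X Y) (gauge Y X)).

Section GRDE.
Context {F : realType} {n k : nat}.
Context (A : 'M[F]_n) (B : 'M[F]_(n, k)) (C : 'M[F]_n) (D : 'M[F]_(n, k)).
Context (L : 'M[F]_(k, n)) (Q : 'M[F]_n) (R : 'M[F]_k).

Definition grde_field (P : 'M[F]_n) : 'M[F]_n :=
  A^T *m P + P *m A + C^T *m P *m C + Q
  - (B^T *m P + D^T *m P *m C + L)^T *m invmx (R + D^T *m P *m D)
    *m (B^T *m P + D^T *m P *m C + L).

(* The equation is imposed on the open interval ]0, t[ only: [grde_field] being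
   continuous where [R + D^T P D] is invertible, continuity of [P] on [0, t]
   then yields the one-sided derivatives at 0 and at t. *)
Definition grde_solution (G : 'M[F]_n) (t : F) (P : F -> 'M[F]_n) : Prop :=
  [/\ P 0 = G,
      {within `[0, t], continuous P},
      (forall s, s \in `]0, t[ -> is_derive s 1 P (grde_field (P s))) &
      (forall s, s \in `[0, t] ->
         posdef (P s) /\ posdef (R + D^T *m P s *m D))].

(* [grde_field] is locally Lipschitz where [R + D^T P D] is positive definite,
   so two solutions from [G] agree on their common domain; the maximal solution
   from [G] is the union of all of them, and [maximal_domain G] is its interval
   of definition.  [maximal_solution] has the junk value 0 outside it. *)
Definition maximal_domain (G : 'M[F]_n) : set F :=
  [set t | 0 <= t /\ exists P, grde_solution G t P].

Definition maximal_solution (G : 'M[F]_n) (t : F) : 'M[F]_n :=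
  xget 0 [set P t | P in grde_solution G t].

Definition grde_flow (t : F) (G : 'M[F]_n) : 'M[F]_n := maximal_solution G t.

End GRDE.

(* Main.v *)
Require Import Defs.
From HB Require Import structures.
From mathcomp Require Import all_boot all_order all_algebra.
From mathcomp Require Import all_classical all_reals all_analysis.
From mathcomp Require Import ring lra.

Set Implicit Arguments.
Unset Strict Implicit.
Unset Printing Implicit Defensive.

Import Order.TTheory GRing.Theory Num.Theory.
Import numFieldNormedType.Exports.

Local Open Scope classical_set_scope.
Local Open Scope ring_scope.

(** The Riccati field is a pointwise minimum of functions affine in P.  With
    N = R + D'PD and S = B'P + D'PC + L, completing the square gives, for every
    vector v and every control u,

      v' phi(P) v = H(P, v, u) - (u + N^-1 S v)' N (u + N^-1 S v),

    where H(P, v, u) = 2 v'P(Av + Bu) + (Cv + Du)'P(Cv + Du) + w(v, u) and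
    w(v, u) is the value of the block form with blocks Q, L', L, R at (v, u)
    ([hamiltonianE]).  So v' phi(P) v is the minimum of H(P, v, u) over u, and
    the only term of H that does not scale with P is the running cost w, which
    is positive definite.

    Let P1, P2 be two solutions with P1(0) < e^d P2(0), and follow
    X = l P2 - P1 for l(s) = exp(d e^(-a s)).  Suppose that X(s) is positive
    semidefinite with a null vector v.  Using at P1 the control u that is
    optimal for P2 gives l v'phi(P2)v - v'phi(P1)v >= (l - 1) w(v, u)
    ([grde_field_touching]).  On the other hand, writing h = d e^(-a s), the
    factor l contributes l' v'P2 v = -a h l v'P2 v = -a h v'P1 v.  As
    l - 1 >= h > 0, the derivative of v'Xv at s is at least
    h (w(v, u) - a v'P1 v), which is positive as soon as a v'P1 v < w(v, u).
    Hence X cannot leave the cone ([psd_no_exit]) and P1(t) <= l(t) P2(t)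
    ([grde_comparison]).  The point of replacing l P2 v by P1 v at the moment of
    contact is that an upper bound on the solutions is then enough to choose a,
    however large d is: this is why the contraction is uniform on sets bounded
    from above.

    Exchanging P1 and P2 and letting d decrease to the Thompson distance of the
    initial values gives the contraction by e^(-a t) ([grde_contraction]).  With
    a = 0 the same inequality says that solutions are unique, which identifies
    the flow with any given solution ([grde_flowE]).  The strict contraction
    follows because a solution on the compact interval [0, t] is bounded. *)

(** * Quadratic forms *)

Section QuadraticForms.
Context {F : realType}.

Definition dot {m} (x y : 'cV[F]_m) : F := (x^T *m y) 0 0.

Definition qf {m} (X : 'M[F]_m) (x : 'cV[F]_m) : F := (x^T *m X *m x) 0 0.

Lemma qfE m (X : 'M[F]_m) x : qf X x = dot x (X *m x).
Proof. by rewrite /qf /dot mulmxA. Qed.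

Lemma dotE m (x y : 'cV[F]_m) : dot x y = \sum_i x i 0 * y i 0.
Proof. by rewrite /dot mxE; apply: eq_bigr => i _; rewrite mxE. Qed.

Lemma dotC m (x y : 'cV[F]_m) : dot x y = dot y x.
Proof. by rewrite !dotE; apply: eq_bigr => i _; rewrite mulrC. Qed.

Lemma dotDl m (x y z : 'cV[F]_m) : dot (x + y) z = dot x z + dot y z.
Proof. by rewrite /dot linearD mulmxDl mxE. Qed.

Lemma dotDr m (x y z : 'cV[F]_m) : dot z (x + y) = dot z x + dot z y.
Proof. by rewrite /dot mulmxDr mxE. Qed.

Lemma dotZl m a (x y : 'cV[F]_m) : dot (a *: x) y = a * dot x y.
Proof. by rewrite /dot linearZ -scalemxAl mxE. Qed.

Lemma dotZr m a (x y : 'cV[F]_m) : dot x (a *: y) = a * dot x y.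
Proof. by rewrite /dot -scalemxAr mxE. Qed.

Lemma dotNr m (x y : 'cV[F]_m) : dot x (- y) = - dot x y.
Proof. by rewrite -scaleN1r dotZr mulN1r. Qed.

Lemma dot0r m (x : 'cV[F]_m) : dot x 0 = 0.
Proof. by rewrite /dot mulmx0 mxE. Qed.

Lemma dot_mulmx m p (X : 'M[F]_(m, p)) x y : dot x (X *m y) = dot (X^T *m x) y.
Proof. by rewrite /dot trmx_mul trmxK mulmxA. Qed.

Lemma dot_ge0 m (x : 'cV[F]_m) : 0 <= dot x x.
Proof. by rewrite dotE sumr_ge0 // => i _; rewrite -expr2 sqr_ge0. Qed.

Lemma dot_eq0 m (x : 'cV[F]_m) : dot x x = 0 -> x = 0.
Proof.
rewrite dotE => /eqP; rewrite psumr_eq0; last first.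
  by move=> i _; rewrite -expr2 sqr_ge0.
move=> /allP x0; apply/matrixP => i j; rewrite ord1 mxE.
by have := x0 i (mem_index_enum _); rewrite /= mulf_eq0 orbb => /eqP.
Qed.

Lemma dot_gt0 m (x : 'cV[F]_m) : x != 0 -> 0 < dot x x.
Proof.
by rewrite lt_neqAle dot_ge0 andbT; apply: contraNneq => /esym/dot_eq0 ->.
Qed.

Lemma qfD m (X Y : 'M[F]_m) x : qf (X + Y) x = qf X x + qf Y x.
Proof. by rewrite !qfE mulmxDl dotDr. Qed.

Lemma qfZ m a (X : 'M[F]_m) x : qf (a *: X) x = a * qf X x.
Proof. by rewrite !qfE -scalemxAl dotZr. Qed.

Lemma qfN m (X : 'M[F]_m) x : qf (- X) x = - qf X x.
Proof. by rewrite -scaleN1r qfZ mulN1r. Qed.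

Lemma qfB m (X Y : 'M[F]_m) x : qf (X - Y) x = qf X x - qf Y x.
Proof. by rewrite qfD qfN. Qed.

Lemma qf_sum m (X : 'M[F]_m) x :
  qf X x = \sum_i \sum_j x i 0 * x j 0 * X i j.
Proof.
rewrite qfE dotE; apply: eq_bigr => i _; rewrite mxE mulr_sumr.
by apply: eq_bigr => j _; rewrite mulrA mulrAC.
Qed.

Lemma entry_le_norm m p (X : 'M[F]_(m, p)) i j : `|X i j| <= `|X|.
Proof.
rewrite [leRHS]/Num.Def.normr /= mx_normrE.
exact: (le_bigmax _ (fun ij => `|X ij.1 ij.2|) (i, j)).
Qed.

Lemma qf_le_norm m (X : 'M[F]_m) x : `|qf X x| <= m%:R * `|X| * dot x x.
Proof.
have -> : m%:R * `|X| * dot x x =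
    \sum_i \sum_j (`|X| / 2 * (x i 0 * x i 0) + `|X| / 2 * (x j 0 * x j 0)).
  under eq_bigr => i _ do rewrite big_split /= sumr_const card_ord -mulr_sumr -dotE.
  rewrite big_split /= sumr_const card_ord sumrMnl -mulr_sumr -dotE.
  rewrite -[X in _ = X + _]mulr_natl -[X in _ = _ + X]mulr_natl.
  by move: (dot x x) `|X| (m%:R : F) => d c e; field.
rewrite qf_sum; apply: le_trans (ler_norm_sum _ _ _) _; apply: ler_sum => i _.
apply: le_trans (ler_norm_sum _ _ _) _; apply: ler_sum => j _.
rewrite normrM; apply: le_trans (ler_wpM2l (normr_ge0 _) (entry_le_norm X i j)) _.
rewrite normrM -(normr_id X).
rewrite -[x i 0 * x i 0]expr2 -[x j 0 * x j 0]expr2.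
rewrite -(real_normK (num_real (x i 0))) -(real_normK (num_real (x j 0))).
rewrite normr_id.
have := sqr_ge0 (`|x i 0| - `|x j 0|); have := normr_ge0 X.
move: `|x i 0| `|x j 0| `|X| => a b c c0 ab.
have := mulr_ge0 c0 ab; lra.
Qed.

Lemma posdef_psd m (X : 'M[F]_m) : posdef X -> psd X.
Proof.
move=> [symX pX]; split => // x.
have [->|/pX/ltW //] := eqVneq x 0; by rewrite mulmx0 mxE.
Qed.

Lemma dot_symC m (X : 'M[F]_m) x y : X^T = X -> dot x (X *m y) = dot y (X *m x).
Proof. by move=> symX; rewrite dot_mulmx symX dotC. Qed.

Lemma qf_add m (X : 'M[F]_m) x y : X^T = X ->
  qf X (x + y) = qf X x + 2 * dot y (X *m x) + qf X y.
Proof.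
move=> symX; rewrite !qfE mulmxDr !(dotDl, dotDr).
rewrite (dot_symC x y symX); ring.
Qed.

Lemma qf_scale m a (X : 'M[F]_m) x : qf X (a *: x) = a ^+ 2 * qf X x.
Proof. by rewrite !qfE -scalemxAr dotZl dotZr mulrA. Qed.

(** The form of X at x + a y is a nonnegative quadratic polynomial in a; it is
    evaluated at its minimiser, or far away when its leading coefficient
    vanishes. *)
Lemma psd_cauchy_schwarz m (X : 'M[F]_m) x y : psd X ->
  dot y (X *m x) ^+ 2 <= qf X x * qf X y.
Proof.
move=> [symX pX].
have poly a : 0 <= qf X x + 2 * a * dot y (X *m x) + a ^+ 2 * qf X y.
  have := pX (x + a *: y); rewrite -/(qf _ _) qf_add // qf_scale dotZl; lra.
have qx : 0 <= qf X x := pX x.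
have := pX y; rewrite -/(qf X y) le_eqVlt => /predU1P[qy0|qy].
  rewrite -qy0 mulr0.
  set b := dot _ _ in poly *.
  have [->|b0] := eqVneq b 0; first by rewrite expr0n.
  have := poly (- (qf X x + 1) / (2 * b)); rewrite -qy0.
  have -> : qf X x + 2 * (- (qf X x + 1) / (2 * b)) * b
     + (- (qf X x + 1) / (2 * b)) ^+ 2 * 0 = - 1 by field.
  by rewrite oppr_ge0 ler10.
have := poly (- dot y (X *m x) / qf X y).
set b := dot _ _; set q := qf X y in qy *.
have -> : qf X x + 2 * (- b / q) * b + (- b / q) ^+ 2 * q = (qf X x * q - b ^+ 2) / q.
  by field; rewrite gt_eqF.
by rewrite pmulr_lge0 ?invr_gt0 // subr_ge0.
Qed.

(** A semidefinite form that vanishes at x is minimal there, so its gradient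
    vanishes; in the comparison argument this turns a touching direction into a
    null vector of the difference. *)
Lemma psd_null m (X : 'M[F]_m) x : psd X -> qf X x = 0 -> X *m x = 0.
Proof.
move=> pX qx0; apply: dot_eq0; apply/eqP; rewrite -sqrf_eq0 eq_le sqr_ge0 andbT.
by apply: le_trans (psd_cauchy_schwarz _ _ pX) _; rewrite qx0 mul0r.
Qed.

Lemma psd_antisym m (X Y : 'M[F]_m) :
  loewner_le X Y -> loewner_le Y X -> X = Y.
Proof.
move=> XY [_ YX]; apply/eqP; rewrite eq_sym -subr_eq0; apply/eqP/matrixP => i j.
have -> : (Y - X) i j = ((Y - X) *m delta_mx j (0 : 'I_1)) i 0.
  by rewrite -colE [RHS]mxE.
rewrite (psd_null XY) ?mxE //; apply: le_anti; rewrite (XY.2 _) andbT.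
by have := YX (delta_mx j 0); rewrite -/(qf _ _) -opprB qfN oppr_ge0.
Qed.

Lemma posdef_unitmx m (X : 'M[F]_m) : posdef X -> X \in unitmx.
Proof.
move=> [symX pX]; rewrite -row_free_unit -kermx_eq0; apply/eqP/row_matrixP => i.
rewrite row0; apply: contrapT => /eqP/negP ki0.
have kX : (row i (kermx X)) *m X = 0 by rewrite -row_mul mulmx_ker row0.
have := pX (row i (kermx X))^T; rewrite trmxK kX mul0mx mxE ltxx => H.
suff // : false by []; apply: H; apply: contra_notN ki0 => /eqP H.
by rewrite -(trmxK (row _ _)) H trmx0.
Qed.

(** Cauchy-Schwarz for X between x and X^-1 x reads
    (x'x)^2 <= (x'X^-1 x)(x'Xx), and x'X^-1 x is at most a multiple of x'x. *)
Lemma posdef_coercive m (X : 'M[F]_m) : posdef X ->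
  exists2 e, 0 < e & forall x, e * dot x x <= qf X x.
Proof.
move=> pX; have uX := posdef_unitmx pX; have [symX X0] := pX.
have c0 : 0 <= m%:R * `|invmx X| by rewrite mulr_ge0.
exists (m%:R * `|invmx X| + 1)^-1; first by rewrite invr_gt0 ltr_wpDl.
move=> x; rewrite mulrC ler_pdivrMr ?ltr_wpDl //.
have [->|x0] := eqVneq x 0; first by rewrite dot0r qfE mulmx0 dot0r mul0r.
have := psd_cauchy_schwarz (invmx X *m x) x (posdef_psd pX).
rewrite [qf X (invmx _ *m _)]qfE mulKVmx // [dot (invmx _ *m _) _]dotC -qfE => CS.
have bI : qf (invmx X) x <= m%:R * `|invmx X| * dot x x.
  exact: le_trans (ler_norm _) (qf_le_norm _ _).
have d0 := dot_gt0 x0; have q0 := X0 x x0; rewrite -/(qf X x) in q0.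
rewrite -(ler_pM2l d0) -expr2; apply: le_trans CS _.
have := ler_wpM2r (ltW q0) bI; have := mulr_ge0 (ltW d0) (ltW q0); lra.
Qed.
End QuadraticForms.

(** * The Riccati field as a minimum over controls *)

Section Riccati.
Context {F : realType} {n k : nat}.
Context (A : 'M[F]_n) (B : 'M[F]_(n, k)) (C : 'M[F]_n) (D : 'M[F]_(n, k)).
Context (L : 'M[F]_(k, n)) (Q : 'M[F]_n) (R : 'M[F]_k).

Let phi := grde_field A B C D L Q R.
Let cost := block_mx Q L^T L R.

(** This is the drift of x'Px along dx = (Ax + Bu) dt + (Cx + Du) dW at x = v,
    plus the running cost of the linear-quadratic control problem whose value
    function, in reversed time, solves the equation. *)
Definition hamiltonian (P : 'M[F]_n) (v : 'cV[F]_n) (u : 'cV[F]_k) : F :=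
  2 * dot v (P *m (A *m v + B *m u)) + qf P (C *m v + D *m u)
  + qf cost (col_mx v u).

Lemma dot_col_mx m p (a c : 'cV[F]_m) (b d : 'cV[F]_p) :
  dot (col_mx a b) (col_mx c d) = dot a c + dot b d.
Proof. by rewrite /dot tr_col_mx mul_row_col mxE. Qed.

Lemma qf_block v u :
  qf cost (col_mx v u) = qf Q v + 2 * dot u (L *m v) + qf R u.
Proof.
rewrite qfE mul_block_col dot_col_mx !dotDr -!qfE.
have -> : dot v (L^T *m u) = dot u (L *m v) by rewrite dot_mulmx trmxK dotC.
ring.
Qed.

(** Completion of the square in the control. *)
Lemma hamiltonianE P v u : R^T = R -> P^T = P ->
    let N := R + D^T *m P *m D in
    N \in unitmx ->
  hamiltonian P v u = qf (phi P) v
    + qf N (u + invmx N *m ((B^T *m P + D^T *m P *m C + L) *m v)).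
Proof.
move=> symR symP N uN.
have symN : N^T = N by rewrite linearD /= !trmx_mul trmxK symP symR mulmxA.
rewrite /phi /grde_field -/N; set S := _ + L; set w := S *m v.
set z := invmx N *m w.
have Nz : N *m z = w by rewrite mulKVmx.
rewrite qf_add // (dot_symC z u symN) Nz (qfE N z) Nz.
rewrite !(qfB, qfD).
have -> : qf (S^T *m invmx N *m S) v = dot z w.
  by rewrite qfE -!mulmxA dot_mulmx trmxK -/w dotC.
have -> : qf (A^T *m P) v = dot v (P *m (A *m v)).
  by rewrite qfE -mulmxA dot_mulmx trmxK (dot_symC _ _ symP).
have -> : qf (P *m A) v = dot v (P *m (A *m v)) by rewrite qfE -mulmxA.
have -> : qf (C^T *m P *m C) v = qf P (C *m v).
  by rewrite !qfE -!mulmxA dot_mulmx trmxK.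
have -> : qf (D^T *m P *m D) u = qf P (D *m u).
  by rewrite !qfE -!mulmxA dot_mulmx trmxK.
have -> : dot u w = dot v (P *m (B *m u)) + dot (D *m u) (P *m (C *m v))
    + dot u (L *m v).
  rewrite /w /S !mulmxDl !dotDr -!mulmxA; congr (_ + _ + _).
    by rewrite dot_mulmx trmxK (dot_symC _ _ symP).
  by rewrite dot_mulmx trmxK.
rewrite /hamiltonian qf_block (qf_add _ _ symP) mulmxDr dotDr; ring.
Qed.

(** P -> H(P, v, u) is affine; the cost is its constant part, hence the surplus
    l - 1. *)
Lemma hamiltonian_comb P1 P2 l v u :
  l * hamiltonian P2 v u - hamiltonian P1 v u =
  2 * dot v ((l *: P2 - P1) *m (A *m v + B *m u))
  + qf (l *: P2 - P1) (C *m v + D *m u) + (l - 1) * qf cost (col_mx v u).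
Proof.
rewrite /hamiltonian qfB qfZ mulmxBl -scalemxAl dotDr dotZr dotNr; ring.
Qed.

Definition optimal_control P v : 'cV[F]_k :=
  - (invmx (R + D^T *m P *m D) *m ((B^T *m P + D^T *m P *m C + L) *m v)).

(** The field is quasimonotone and strictly subhomogeneous: the control that
    attains the minimum for P2 is merely admissible for P1, and the drift terms
    of l P2 - P1 are nonnegative at a null vector. *)
Lemma grde_field_touching P1 P2 l v :
    R^T = R -> P1^T = P1 -> P2^T = P2 ->
    posdef (R + D^T *m P1 *m D) -> posdef (R + D^T *m P2 *m D) ->
    psd (l *: P2 - P1) -> (l *: P2 - P1) *m v = 0 ->
  (l - 1) * qf cost (col_mx v (optimal_control P2 v))
    <= l * qf (phi P2) v - qf (phi P1) v.
Proof.
move=> symR sym1 sym2 N1 N2 psdX Xv; set u := optimal_control P2 v.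
have -> : qf (phi P2) v = hamiltonian P2 v u.
  rewrite hamiltonianE ?posdef_unitmx // /u /optimal_control addNr.
  by rewrite [qf _ 0]qfE mulmx0 dot0r addr0.
have le1 : qf (phi P1) v <= hamiltonian P1 v u.
  rewrite hamiltonianE ?posdef_unitmx // lerDl.
  exact: (posdef_psd N1).2.
apply: le_trans (lerB (lexx _) le1); rewrite hamiltonian_comb.
rewrite dot_mulmx psdX.1 Xv dotC dot0r mulr0 add0r lerDr.
exact: psdX.2.
Qed.
End Riccati.

(** * Matrix paths that stay in the semidefinite cone *)

Section FirstExit.
Context {F : realType}.

Lemma within_itv_near (U : normedModType F) (f : F -> U) (t s e : F) :
    {within `[0, t], continuous f} -> s \in `[0, t] -> 0 < e ->
  exists2 d : F, 0 < d & forall r : F, r \in `[0, t] -> `|r - s| < d -> `|f r - f s| < e.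
Proof.
move=> cf st e0; have st' : `[0, t]%classic s by [].
have /cvgrPdist_lt/(_ e e0) cfs := cf s.
have : nbhs_subspace (s : subspace `[0, t]) [set r | `|f s - f r| < e] := cfs.
rewrite -(nbhs_subspace_in st') => -[d /= d0 Hd]; exists d => // r rt rs.
by rewrite distrC; apply: Hd => //=; rewrite distrC.
Qed.

Lemma qf_near n (X : F -> 'M[F]_n) (t s e : F) :
    {within `[0, t], continuous X} -> s \in `[0, t] -> 0 < e ->
  exists2 d : F, 0 < d & forall r : F, r \in `[0, t] -> `|r - s| < d ->
    forall v, `|qf (X r) v - qf (X s) v| <= e * dot v v.
Proof.
move=> cX st e0; have n0 : 0 < n%:R + 1 :> F by rewrite ltr_wpDl.
have [d d0 Hd] := within_itv_near cX st (divr_gt0 e0 n0).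
exists d => // r rt /(Hd r rt) Xrs v; rewrite -qfB.
apply: le_trans (qf_le_norm _ _) _; rewrite ler_wpM2r ?dot_ge0 //.
apply: (@le_trans _ _ ((n%:R + 1) * `|X r - X s|)).
  by rewrite ler_wpM2r // lerDl.
by rewrite mulrC -ler_pdivlMr // ltW.
Qed.

Lemma posdef_near n (X : F -> 'M[F]_n) (t s : F) :
    {within `[0, t], continuous X} -> s \in `[0, t] ->
    (forall r : F, r \in `[0, t] -> (X r)^T = X r) -> posdef (X s) ->
  exists2 d : F, 0 < d & forall r : F, r \in `[0, t] -> `|r - s| < d -> posdef (X r).
Proof.
move=> cX st symX /posdef_coercive[e e0 He].
have e20 : 0 < e / 2 by rewrite divr_gt0.
have [d d0 Hd] := qf_near cX st e20.
exists d => // r rt rs; split; first exact: symX.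
move=> v v0; rewrite -/(qf _ _).
have := Hd r rt rs v; rewrite ler_norml => /andP[+ _].
have := He v; have := dot_gt0 v0; nra.
Qed.

Lemma qf_neg_near n (X : F -> 'M[F]_n) (t s : F) v :
    {within `[0, t], continuous X} -> s \in `[0, t] -> qf (X s) v < 0 ->
  exists2 d : F, 0 < d & forall r : F, r \in `[0, t] -> `|r - s| < d -> qf (X r) v < 0.
Proof.
move=> cX st q0; have v0 : v != 0.
  by apply: contraTneq q0 => ->; rewrite qfE mulmx0 dot0r ltxx.
have d0 := dot_gt0 v0.
have e0 : 0 < - qf (X s) v / (2 * dot v v).
  by rewrite divr_gt0 ?oppr_gt0 // mulr_gt0.
have [d ? Hd] := qf_near cX st e0; exists d => // r rt rs.
have := Hd r rt rs v; rewrite ler_norml => /andP[_].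
have -> : - qf (X s) v / (2 * dot v v) * dot v v = - qf (X s) v / 2.
  by field; rewrite gt_eqF.
lra.
Qed.

Lemma derive_gt0_left (g : F -> F) (s d : F) : is_derive s 1 g d -> 0 < d ->
  exists2 e : F, 0 < e & forall r : F, s - e < r -> r < s -> g r < g s.
Proof.
move=> [dg <-] d0; have /cvgrPdist_lt/(_ _ d0) [e /= e0 He] := dg.
exists e => // r er rs.
have /He : ball_ Num.norm 0 e (r - s) by rewrite /= sub0r normrN ltr_norml; lra.
have rs0 : r - s < 0 by lra.
move=> /(_ (ltr0_neq0 rs0)); rewrite /GRing.scale /= mulr1 subrK.
rewrite -/(GRing.scale _ _) ltr_norml => /andP[_]; rewrite -subr_gt0 opprB addrC subrK.
by rewrite nmulr_rgt0 ?invr_lt0 // subr_lt0.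
Qed.

(** Were X(t) not semidefinite, let s be the infimum of the times at which X is
    not positive definite.  Openness of definiteness gives 0 < s < t and a null
    vector w of the semidefinite X(s); w'Xw would be nonnegative before s,
    vanish at s and have a positive derivative there. *)
Lemma psd_no_exit n (X : F -> 'M[F]_n) (t : F) : 0 <= t ->
    {within `[0, t], continuous X} ->
    (forall s : F, s \in `[0, t] -> (X s)^T = X s) ->
    posdef (X 0) ->
    (forall (s : F) v, s \in `]0, t[ -> psd (X s) -> v != 0 -> X s *m v = 0 ->
      exists2 d : F, 0 < d & is_derive s 1 (fun r => qf (X r) v) d) ->
  psd (X t).
Proof.
move=> t0 cX symX X0 dX.
have tt : t \in `[0, t] by rewrite in_itv /= t0 lexx.
split; first exact: symX.
move=> v; rewrite -/(qf _ _) leNgt; apply/negP => qv.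
have [d1 d10 Hd1] := qf_neg_near cX tt qv.
have tpos : 0 < t.
  rewrite lt_neqAle t0 andbT; apply/eqP => t00; move: qv.
  by rewrite ltNge -t00 (posdef_psd X0).2.
(* Derivatives are known only inside the interval, so the failure at [t] is first
   moved to an earlier time. *)
have [t1 /andP[t10 t1t] qt1] : exists2 t1, 0 < t1 < t & qf (X t1) v < 0.
  exists (t - Num.min d1 t / 2).
    have : Num.min d1 t <= t by rewrite ge_min lexx orbT.
    have : 0 < Num.min d1 t by rewrite lt_min d10.
    by move=> *; apply/andP; split; lra.
  have : Num.min d1 t <= t by rewrite ge_min lexx orbT.
  have : Num.min d1 t <= d1 by rewrite ge_min lexx.
  have : 0 < Num.min d1 t by rewrite lt_min d10.
  move=> *; apply: Hd1; first by rewrite in_itv /=; apply/andP; split; lra.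
  by rewrite ltr_norml; apply/andP; split; lra.
pose E := [set s | s \in `[0, t] /\ ~ posdef (X s)].
have Elb : has_lbound E by exists 0 => s [+ _]; rewrite in_itv /= => /andP[].
have Et1 : E t1.
  split; first by rewrite in_itv /= !ltW.
  by move=> /posdef_psd[_ /(_ v)]; rewrite leNgt; apply/negP; rewrite negbK.
have E0 : E !=set0 by exists t1.
pose s := inf E.
have s_ge0 : 0 <= s.
  by apply: lb_le_inf => // r [+ _]; rewrite in_itv /= => /andP[].
have s_t : s < t by apply: le_lt_trans t1t; exact: ge_inf.
have st : s \in `[0, t] by rewrite in_itv /= s_ge0 ltW.
have below r : 0 <= r -> r < s -> posdef (X r).
  move=> r0 rs; apply: contrapT => nX.
  suff : s <= r by rewrite leNgt rs.
  apply: ge_inf => //; split => //; rewrite in_itv /= r0 ltW //.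
  exact: lt_trans rs s_t.
have nXs : ~ posdef (X s).
  move=> pXs; have [d d0 Hd] := posdef_near cX st symX pXs.
  have [|r [rt nXr] rs] := inf_lt (x := s + d) E0; first by rewrite ltrDl.
  have sr : s <= r by apply: ge_inf => //; split.
  apply: nXr; apply: Hd => //.
  by rewrite ltr_norml; apply/andP; split; lra.
have s0 : 0 < s.
  by rewrite lt_neqAle s_ge0 andbT; apply/eqP => s0; apply: nXs; rewrite -s0.
have psdXs : psd (X s).
  split; first exact: symX.
  move=> w; rewrite -/(qf _ _) leNgt; apply/negP => qw.
  have [d d0 Hd] := qf_neg_near cX st qw.
  have ms : Num.min d s <= s by rewrite ge_min lexx orbT.
  have md : Num.min d s <= d by rewrite ge_min lexx.
  have m0 : 0 < Num.min d s by rewrite lt_min d0.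
  have r0 : 0 <= s - Num.min d s / 2 by lra.
  have rs : s - Num.min d s / 2 < s by lra.
  have := (posdef_psd (below _ r0 rs)).2 w; rewrite leNgt => /negP; apply.
  apply: Hd; first by rewrite in_itv /= r0 ltW //; exact: lt_trans rs s_t.
  by rewrite ltr_norml; apply/andP; split; lra.
have [w w0 qw0] : exists2 w, w != 0 & qf (X s) w = 0.
  apply: contrapT => nw; apply: nXs; split; first exact: symX.
  move=> w w0; rewrite lt_neqAle psdXs.2 andbT; apply/eqP => qw.
  by apply: nw; exists w.
have s_in : s \in `]0, t[ by rewrite in_itv /= s0.
have [d d0 dq] := dX s w s_in psdXs w0 (psd_null psdXs qw0).
have [e e0 He] := derive_gt0_left dq d0.
have ms : Num.min e s <= s by rewrite ge_min lexx orbT.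
have me : Num.min e s <= e by rewrite ge_min lexx.
have m0 : 0 < Num.min e s by rewrite lt_min e0.
have r0 : 0 <= s - Num.min e s / 2 by lra.
have rs : s - Num.min e s / 2 < s by lra.
have er : s - e < s - Num.min e s / 2 by lra.
have := He _ er rs; rewrite qw0 ltNge => /negP; apply.
exact: (posdef_psd (below _ r0 rs)).2.
Qed.

End FirstExit.

(** * Comparison of two solutions *)

Section Comparison.
Context {F : realType} {n k : nat}.
Context (A : 'M[F]_n) (B : 'M[F]_(n, k)) (C : 'M[F]_n) (D : 'M[F]_(n, k)).
Context (L : 'M[F]_(k, n)) (Q : 'M[F]_n) (R : 'M[F]_k).

Let phi := grde_field A B C D L Q R.
Let cost := block_mx Q L^T L R.
Let solution := grde_solution A B C D L Q R.

Lemma is_derive_qf (P : F -> 'M[F]_n) (s : F) dP v :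
  is_derive s 1 P dP -> is_derive s 1 (fun r => qf (P r) v) (qf dP v).
Proof.
move=> [Pd <-]; rewrite (derive_mx Pd) qf_sum.
have -> : (fun r => qf (P r) v) =
    \sum_i \sum_j (fun r => v i 0 * v j 0 *: P r i j).
  apply/funext => r; rewrite fct_sumE qf_sum; apply: eq_bigr => i _.
  by rewrite fct_sumE.
apply: is_derive_sum => i; apply: is_derive_sum => j.
rewrite mxE; apply: is_deriveZ; apply: DeriveDef => //.
by move/derivable_mxP : Pd.
Qed.

(** The factor exp(d e^(-a s)) is the one for which its logarithm, hence the
    Thompson distance, decays exactly at rate a. *)
Lemma grde_comparison G1 G2 P1 P2 (t a d : F) : R^T = R -> 0 <= t ->
    solution G1 t P1 -> solution G2 t P2 -> 0 < d ->
    (forall (s : F) v u, s \in `]0, t[ -> v != 0 ->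
       a * qf (P1 s) v < qf cost (col_mx v u)) ->
    (forall v u, v != 0 -> 0 < qf cost (col_mx v u)) ->
    posdef (expR d *: G2 - G1) ->
  loewner_le (P1 t) (expR (expR (- a * t) * d) *: P2 t).
Proof.
move=> symR t0 [P10 c1 d1 p1] [P20 c2 d2 p2] d0 bound cost_gt0 pos0.
pose eta (s : F) := expR (- a * s) * d.
have eta_gt0 s : 0 < eta s by rewrite mulr_gt0 ?expR_gt0.
pose X s := expR (eta s) *: P2 s - P1 s.
have deta (s : F) : is_derive s 1 eta (- a * eta s).
  by apply: is_derive_eq; rewrite scaler0 add0r /eta /GRing.scale /=; ring.
have dexp (s : F) : is_derive s 1 (fun r => expR (eta r)) (expR (eta s) * (- a * eta s)).
  exact: (is_derive1_comp (f := expR)).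
have cexp : {within `[0, t], continuous (fun r => expR (eta r))}.
  apply: continuous_subspaceT => r; apply/differentiable_continuous/derivable1_diffP.
  by have [] := dexp r.
apply: (@psd_no_exit _ _ X) => //.
- move=> x; apply: cvgB; last exact: c1.
  apply: cvgZ; last exact: c2.
  exact: cexp.
- by move=> s st; rewrite /X linearB linearZ /= (p1 s st).1.1 (p2 s st).1.1.
- by rewrite /X /eta P10 P20 mulr0 expR0 mul1r.
move=> s v s_in psdX v0 Xv.
have s_itv : s \in `[0, t].
  by move: s_in; rewrite !in_itv /= => /andP[? ?]; rewrite !ltW.
have [[[sym1 _] N1] [[sym2 _] N2]] := (p1 s s_itv, p2 s s_itv).
exists (expR (eta s) * qf (phi (P2 s)) v
    + qf (P2 s) v * (expR (eta s) * (- a * eta s)) - qf (phi (P1 s)) v); last first.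
  have -> : (fun r => qf (X r) v) =
      (fun r => expR (eta r)) * (fun r => qf (P2 r) v) - (fun r => qf (P1 r) v).
    by apply/funext => r; rewrite /X qfB qfZ.
  by apply: is_deriveB; [apply: is_deriveM|]; apply: is_derive_qf; [exact: d2|exact: d1].
have touch := @grde_field_touching _ _ _ A B C D L Q R _ _ _ _
  symR sym1 sym2 N1 N2 psdX Xv.
(* At a touching direction the factor times [P2] becomes [P1], so that only a
   bound on [P1] enters, uniformly in [d]. *)
have qX : expR (eta s) * qf (P2 s) v = qf (P1 s) v.
  by apply/eqP; rewrite -subr_eq0 -qfZ -qfB qfE Xv dot0r.
have := bound s v (optimal_control B C D L R (P2 s) v) s_in v0.
have := cost_gt0 v (optimal_control B C D L R (P2 s) v) v0.
move: touch; rewrite -/phi -/cost; set W := qf cost _ => touch W0 aW.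
have : eta s <= expR (eta s) - 1.
  by have := expR_ge1Dx (eta s); lra.
rewrite -(ler_pM2r W0).
have := eta_gt0 s; rewrite -(ltr_pM2l (eta_gt0 s)) in aW.
have -> : qf (P2 s) v * (expR (eta s) * (- a * eta s)) = - (eta s * (a * qf (P1 s) v)).
  by rewrite -qX; ring.
lra.
Qed.

End Comparison.

(** * The Thompson metric *)

Section Thompson.
Context {F : realType} {n : nat}.
Implicit Types X Y : 'M[F]_n.

Lemma exists_cV_neq0 : (0 < n)%N -> exists v : 'cV[F]_n, v != 0.
Proof.
move=> n0; exists (const_mx 1); apply/eqP => /matrixP/(_ (Ordinal n0) 0).
by rewrite !mxE; apply/eqP/oner_neq0.
Qed.

Lemma loewner_le_qf X Y v : loewner_le X Y -> qf X v <= qf Y v.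
Proof. by move=> [_ /(_ v)]; rewrite -/(qf _ _) qfB subr_ge0. Qed.

Lemma gauge_set_gt0 X Y m : (0 < n)%N -> posdef X -> posdef Y ->
  loewner_le X (m *: Y) -> 0 < m.
Proof.
move=> /exists_cV_neq0[v v0] [_ /(_ v v0) X0] [_ /(_ v v0) Y0] /(loewner_le_qf v).
by rewrite qfZ => /(lt_le_trans X0); rewrite pmulr_lgt0.
Qed.

Lemma gauge_le X Y m : (0 < n)%N -> posdef X -> posdef Y ->
  loewner_le X (m *: Y) -> gauge X Y <= m.
Proof.
move=> n0 pX pY Xm; apply: ge_inf => //; exists 0 => t Xt.
exact: ltW (gauge_set_gt0 n0 pX pY Xt).
Qed.

(** The strict inequality leaves room for a multiple of Y, which makes the
    difference definite; the comparison argument needs this at time 0. *)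
Lemma gauge_lt X Y m : posdef X -> posdef Y -> gauge X Y < m ->
  posdef (m *: Y - X).
Proof.
move=> pX pY; have [e e0 He] := posdef_coercive pY.
have ne : [set t | loewner_le X (t *: Y)] !=set0.
  exists (n%:R * `|X| / e); split.
    by rewrite linearB linearZ /= pX.1 pY.1.
  move=> v; rewrite -/(qf _ _) qfB qfZ subr_ge0.
  apply: le_trans (ler_norm _) _; apply: le_trans (qf_le_norm _ _) _.
  have -> : n%:R * `|X| * dot v v = n%:R * `|X| / e * (e * dot v v).
    by rewrite mulrA divfK // gt_eqF.
  by rewrite ler_wpM2l // divr_ge0 ?mulr_ge0 // ltW.
move=> /(inf_lt ne)[t Xt tm]; split.
  by rewrite linearB linearZ /= pX.1 pY.1.
move=> v v0; rewrite -/(qf _ _) qfB qfZ subr_gt0.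
apply: le_lt_trans (loewner_le_qf v Xt) _; rewrite qfZ ltr_pM2r //.
exact: pY.2.
Qed.

(** Otherwise both X < Y and Y < X. *)
Lemma max_gauge_ge1 X Y : (0 < n)%N -> posdef X -> posdef Y ->
  1 <= Num.max (gauge X Y) (gauge Y X).
Proof.
move=> /exists_cV_neq0[v v0] pX pY; rewrite leNgt gt_max; apply/negP.
move=> /andP[/(gauge_lt pX pY)[_ /(_ v v0)] + /(gauge_lt pY pX)[_ /(_ v v0)]].
by rewrite -!/(qf _ _) !scale1r !qfB; lra.
Qed.

Lemma thompson_ge0 X Y : (0 < n)%N -> posdef X -> posdef Y -> 0 <= thompson X Y.
Proof. by move=> *; apply/ln_ge0/max_gauge_ge1. Qed.

Lemma thompsonC X Y : thompson X Y = thompson Y X.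
Proof. by rewrite /thompson maxC. Qed.

Lemma thompson_lt X Y d : (0 < n)%N -> posdef X -> posdef Y ->
  thompson X Y < d -> posdef (expR d *: Y - X).
Proof.
move=> n0 pX pY Td; apply: gauge_lt => //.
have M0 := lt_le_trans ltr01 (max_gauge_ge1 n0 pX pY).
apply: (@le_lt_trans _ _ (expR (thompson X Y))); last by rewrite ltr_expR.
by rewrite lnK ?posrE // le_max lexx.
Qed.

Lemma thompson_le X Y d : (0 < n)%N -> posdef X -> posdef Y ->
    loewner_le X (expR d *: Y) -> loewner_le Y (expR d *: X) ->
  thompson X Y <= d.
Proof.
move=> n0 pX pY XY YX.
have M0 := lt_le_trans ltr01 (max_gauge_ge1 n0 pX pY).
by rewrite -[leRHS]expRK ler_ln ?posrE ?expR_gt0 // ge_max !gauge_le.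
Qed.

(** If v'Xv > v'Yv, the ratio r of these values exceeds 1, so X < r Y, which
    fails at v. *)
Lemma thompson_eq0 X Y : (0 < n)%N -> posdef X -> posdef Y ->
  thompson X Y = 0 -> X = Y.
Proof.
move=> n0; suff H X' Y' : posdef X' -> posdef Y' -> thompson X' Y' = 0 ->
    loewner_le X' Y'.
  by move=> pX pY XY; apply: psd_antisym; apply: H; rewrite // thompsonC.
move=> pX pY T0; split; first by rewrite linearB /= pX.1 pY.1.
move=> v; rewrite -/(qf _ _) qfB subr_ge0.
have [->|v0] := eqVneq v 0; first by rewrite !qfE !mulmx0 !dot0r.
have X0 : 0 < qf X' v by exact: pX.2.
have Y0 : 0 < qf Y' v by exact: pY.2.
rewrite leNgt; apply/negP => YX.
have r1 : 1 < qf X' v / qf Y' v by rewrite ltr_pdivlMr ?mul1r.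
have : thompson X' Y' < ln (qf X' v / qf Y' v) by rewrite T0 ln_gt0.
move=> /(thompson_lt n0 pX pY)[_ /(_ v v0)]; rewrite -/(qf _ _).
by rewrite qfB qfZ lnK ?posrE ?divr_gt0 // divfK ?gt_eqF // subrr ltxx.
Qed.

Lemma thompson_id X : (0 < n)%N -> posdef X -> thompson X X = 0.
Proof.
move=> n0 pX; apply: le_anti; rewrite thompson_ge0 // andbT.
by apply: thompson_le => //; rewrite expR0 scale1r /loewner_le subrr; split;
  rewrite ?linear0 // => x; rewrite mulmx0 mul0mx mxE.
Qed.

End Thompson.

(** In dimension 0 the gauge is the infimum of the whole line, which has the
    default value 0, as has the logarithm at 0. *)
Lemma thompson_mx0 (F : realType) (X Y : 'M[F]_0) : thompson X Y = 0.
Proof.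
suff g0 (X' Y' : 'M[F]_0) : gauge X' Y' = 0 by rewrite /thompson !g0 maxxx ln0.
apply: inf_out => -[_ [m /(_ (m - 1))]].
suff H : loewner_le X' ((m - 1) *: Y') by move=> /(_ H); lra.
by split; [rewrite [LHS]flatmx0 [RHS]flatmx0|move=> x; rewrite [x]flatmx0 mulmx0 mxE].
Qed.

(** * Contraction of the flow *)

Section Flow.
Context {F : realType} {n k : nat}.
Context {A : 'M[F]_n} {B : 'M[F]_(n, k)} {C : 'M[F]_n} {D : 'M[F]_(n, k)}.
Context {L : 'M[F]_(k, n)} {Q : 'M[F]_n} {R : 'M[F]_k}.

Let cost := block_mx Q L^T L R.
Let solution := grde_solution A B C D L Q R.

Lemma cost_gt0 v u : posdef cost -> v != 0 -> 0 < qf cost (col_mx v u).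
Proof.
move=> pcost v0; apply: pcost.2; apply: contraNneq v0 => vu0.
by rewrite -(col_mxKu v u) vu0 linear0.
Qed.

(** The comparison applies to every d above the initial distance, and the bound
    is continuous in d. *)
Lemma grde_contraction G1 G2 P1 P2 (t a : F) :
    (0 < n)%N -> R^T = R -> posdef cost -> 0 <= t ->
    solution G1 t P1 -> solution G2 t P2 ->
    (forall (s : F) v u, s \in `]0, t[ -> v != 0 ->
       a * qf (P1 s) v < qf cost (col_mx v u)) ->
    (forall (s : F) v u, s \in `]0, t[ -> v != 0 ->
       a * qf (P2 s) v < qf cost (col_mx v u)) ->
  thompson (P1 t) (P2 t) <= expR (- a * t) * thompson G1 G2.
Proof.
move=> n0 symR pcost t0 sol1 sol2 b1 b2.
have [E1 _ _ p1] := sol1; have [E2 _ _ p2] := sol2.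
have i0 : (0 : F) \in `[0, t] by rewrite in_itv /= lexx.
have it : t \in `[0, t] by rewrite in_itv /= lexx andbT.
have pG1 : posdef G1 by rewrite -E1; exact: (p1 0 i0).1.
have pG2 : posdef G2 by rewrite -E2; exact: (p2 0 i0).1.
apply/ler_addgt0Pr => e e0.
pose d := thompson G1 G2 + e / expR (- a * t).
have dT : thompson G1 G2 < d by rewrite ltrDl divr_gt0 ?expR_gt0.
have d0 : 0 < d by apply: le_lt_trans dT; exact: thompson_ge0.
have -> : expR (- a * t) * thompson G1 G2 + e = expR (- a * t) * d.
  by rewrite mulrDr [X in _ = _ + X]mulrC divfK // gt_eqF ?expR_gt0.
have cost0 v u : v != 0 -> 0 < qf cost (col_mx v u) by exact: cost_gt0.
apply: thompson_le => //; [exact: (p1 t it).1|exact: (p2 t it).1| |].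
  by apply: (grde_comparison symR t0 sol1 sol2) => //; exact: thompson_lt.
apply: (grde_comparison symR t0 sol2 sol1) => //; apply: thompson_lt => //.
by rewrite thompsonC.
Qed.

(** The contraction inequality at rate 0, where the bound on the solutions is
    void, applied to equal initial values. *)
Lemma grde_solution_unique G P1 P2 (t : F) : R^T = R -> posdef cost -> 0 <= t ->
  solution G t P1 -> solution G t P2 -> P1 t = P2 t.
Proof.
move=> symR pcost t0 sol1 sol2.
have [n0|n0] := posnP n; first by apply/matrixP => i; exfalso; case: i => m; rewrite n0.
have [E1 _ _ p1] := sol1; have [_ _ _ p2] := sol2.
have i0 : (0 : F) \in `[0, t] by rewrite in_itv /= lexx.
have it : t \in `[0, t] by rewrite in_itv /= lexx andbT.
have [[pos1 _] [pos2 _]] := (p1 t it, p2 t it).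
apply: thompson_eq0 => //; apply: le_anti; rewrite thompson_ge0 // andbT.
have := @grde_contraction G G P1 P2 t 0 n0 symR pcost t0 sol1 sol2.
rewrite thompson_id //; last by rewrite -E1; exact: (p1 0 i0).1.
by rewrite mulr0; apply=> s v u _ v0; rewrite mul0r; exact: cost_gt0.
Qed.

Lemma grde_solution_restrict G P (r t : F) : 0 <= r <= t ->
  solution G t P -> solution G r P.
Proof.
move=> /andP[r0 rt] [E c d p]; split => //.
- apply: continuous_subspaceW c => s; rewrite /= !in_itv /= => /andP[-> sr].
  exact: le_trans rt.
- move=> s; rewrite in_itv /= => /andP[s0 sr]; apply: d.
  by rewrite in_itv /= s0 (lt_le_trans sr).
- move=> s; rewrite in_itv /= => /andP[s0 sr]; apply: p.
  by rewrite in_itv /= s0 (le_trans sr).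
Qed.

Lemma grde_flowE G P (t : F) : R^T = R -> posdef cost -> 0 <= t ->
  solution G t P -> grde_flow A B C D L Q R t G = P t.
Proof.
move=> symR pcost t0 sol; rewrite /grde_flow /maximal_solution.
case: xgetP => [_ -> [P' sol' <-]|/(_ (P t))[]]; last by exists P.
exact: grde_solution_unique sol' sol.
Qed.

Lemma grde_solution_bounded G P (t : F) : 0 <= t -> solution G t P ->
  exists c, forall (s : F) v, s \in `[0, t] -> qf (P s) v <= c * dot v v.
Proof.
move=> t0 [_ cP _ _].
have [s _ Hs] : exists2 s, s \in `[0, t] &
    forall r, r \in `[0, t] -> `|P r| <= `|P s|.
  apply: (@EVT_max _ (fun r => `|P r|)) => //.
  by move=> x; apply: cvg_norm; exact: cP.
exists (n%:R * `|P s|) => r v rt.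
apply: le_trans (ler_norm _) _; apply: le_trans (qf_le_norm _ _) _.
by rewrite ler_wpM2r ?dot_ge0 // ler_wpM2l // Hs.
Qed.

(** The cost is at least e (v'v + u'u) for some e > 0; the rate is e / (|c| + 1),
    where adding 1 makes the inequality strict. *)
Lemma rate_exists (c : F) : posdef cost ->
  exists2 a, 0 < a & forall q v u, v != 0 -> q <= c * dot v v ->
    a * q < qf cost (col_mx v u).
Proof.
move=> pcost; have [e e0 He] := posdef_coercive pcost.
have c0 : 0 < `|c| + 1 by rewrite ltr_wpDl.
exists (e / (`|c| + 1)); first by rewrite divr_gt0.
move=> q v u v0 qc; have d0 := dot_gt0 v0.
apply: (@lt_le_trans _ _ (e / (`|c| + 1) * ((`|c| + 1) * dot v v))).
  rewrite ltr_pM2l ?divr_gt0 //; apply: le_lt_trans qc _.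
  rewrite ltr_pM2r //; by apply: le_lt_trans (ler_norm _) _; rewrite ltrDl.
rewrite mulrA divfK ?gt_eqF //; apply: le_trans (He _).
by rewrite dot_col_mx ler_wpM2l ?(ltW e0) // lerDl dot_ge0.
Qed.

End Flow.

Theorem theorem1p2 (F : realType) (n k : nat)
    (A : 'M[F]_n) (B : 'M[F]_(n, k)) (C : 'M[F]_n) (D : 'M[F]_(n, k))
    (L : 'M[F]_(k, n)) (Q : 'M[F]_n) (R : 'M[F]_k)
    (Qsym : Q^T = Q) (Rsym : R^T = R)
    (block_posdef : posdef (block_mx Q L^T L R)) :
  let domain := maximal_domain A B C D L Q R in
  let M := grde_flow A B C D L Q R in
  (forall (P1 P2 : 'M[F]_n) (t : F),
     posdef P1 -> posdef P2 -> P1 <> P2 ->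
     0 < t -> domain P1 t -> domain P2 t ->
     thompson (M t P1) (M t P2) < thompson P1 P2)
  /\
  (forall S : set 'M[F]_n,
     (forall P, S P -> posdef P) ->
     (exists P0, posdef P0 /\ forall P, S P -> loewner_le P P0) ->
     exists alpha : F, 0 < alpha /\
       forall (P1 P2 : 'M[F]_n) (t : F),
         S P1 -> S P2 ->
         0 <= t -> domain P1 t -> domain P2 t ->
         (forall r : F, 0 <= r <= t -> S (M r P1) /\ S (M r P2)) ->
         thompson (M t P1) (M t P2) <= expR (- alpha * t) * thompson P1 P2).
Proof.
move=> domain M.
have [n0|n0] := posnP n.
  subst n; split=> [P1 P2 t _ _ /[!flatmx0]//|S _ _].
  exists 1; split=> // P1 P2 t *; by rewrite !thompson_mx0 mulr0.
split=> [P1 P2 t p1 p2 neq t0 [_ [X1 sol1]] [_ [X2 sol2]]|S Spos [P0 [pP0 SP0]]].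
  have t0' := ltW t0.
  have [c1 bound1] := grde_solution_bounded t0' sol1.
  have [c2 bound2] := grde_solution_bounded t0' sol2.
  have [a a0 rate] := rate_exists (Num.max c1 c2) block_posdef.
  rewrite /M (grde_flowE Rsym block_posdef t0' sol1).
  rewrite (grde_flowE Rsym block_posdef t0' sol2).
  have Tgt0 : 0 < thompson P1 P2.
    rewrite lt_neqAle thompson_ge0 // andbT eq_sym.
    by apply/eqP => /(thompson_eq0 n0 p1 p2).
  apply: le_lt_trans (grde_contraction (a := a) n0 Rsym block_posdef t0' sol1 sol2 _ _) _.
  - move=> s v u st v0; apply: rate => //; apply: le_trans (bound1 s v _) _.
      exact: subset_itv_oo_cc st.
    by rewrite ler_wpM2r ?dot_ge0 // le_max lexx.
  - move=> s v u st v0; apply: rate => //; apply: le_trans (bound2 s v _) _.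
      exact: subset_itv_oo_cc st.
    by rewrite ler_wpM2r ?dot_ge0 // le_max lexx orbT.
  by rewrite gtr_pMl // expR_lt1 mulNr oppr_lt0 mulr_gt0.
have [a a0 rate] := rate_exists (n%:R * `|P0|) block_posdef.
exists a; split=> // P1 P2 t S1 S2 t0 [_ [X1 sol1]] [_ [X2 sol2]] inS.
rewrite /M (grde_flowE Rsym block_posdef t0 sol1).
rewrite (grde_flowE Rsym block_posdef t0 sol2).
have itv s : s \in `]0, t[ -> 0 <= s <= t.
  by rewrite in_itv /= => /andP[/ltW -> /ltW ->].
have below G X s v : grde_solution A B C D L Q R G t X -> s \in `]0, t[ ->
    S (M s G) -> qf (X s) v <= n%:R * `|P0| * dot v v.
  move=> sol; rewrite in_itv /= => /andP[/ltW s0 /ltW st].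
  rewrite /M (grde_flowE Rsym block_posdef s0 (grde_solution_restrict _ sol)) ?s0 //.
  move=> /SP0/(loewner_le_qf v)/le_trans; apply.
  exact: le_trans (ler_norm _) (qf_le_norm _ _).
apply: (grde_contraction n0 Rsym block_posdef t0 sol1 sol2) => s v u st v0;
  apply: rate => //.
  exact: below sol1 st (inS s (itv s st)).1.
exact: below sol2 st (inS s (itv s st)).2.
Qed.
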